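(* Let $p,q\in\mathbb{R}$ and $P=(p,q)$. For $r\in\mathbb{R}$ let $P'(r)$ be the reflection of $P$ in the fold line $l_r$ (the perpendicular bisector of $A=(-1,0)$ and $A'=(1,2r)$). Let $\mathcal{F}$ be the union of the orbit $\{P'(r): r\in\mathbb{R}\}$ and $\{P\}$. Then $\mathcal{F}$ is the real cubic curve \[F(x,y):=2(q-y)^2-(q+y)(q-y)(p-x)-(p-x)^2(p+x)=0 .\] The point $P$ is the unique singular point of $\mathcal{F}$, and the Hessian of $F$ at $P$ is $-4(4p+q^2)$. Moreover, with $\mathcal{G}$ the parabola $4x+y^2=0$, the following equivalences hold. (a) $P$ is on the left side of $\mathcal{G}$ $\iff$ the orbit of the points $P'$ does not pass through $P$ $\iff$ $P$ is an isolated point of $\mathcal{F}$. (b) $P$ is on $\mathcal{G}$ $\iff$ the orbit of the points $P'$ passes through $P$ just once $\iff$ $P$ is a cusp of $\mathcal{F}$. (c) $P$ is on the right side of $\mathcal{G}$ $\iff$ the orbit of the points $P'$ passes through $P$ twice $\iff$ $P$ is a self-intersection point of $\mathcal{F}$.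
   Context: All points and curves are in the real plane $\mathbb{R}^2$. Let $A=(-1,0)$. A fold placing $A$ onto the line $x=1$ is the reflection in a line $l$ such that the reflection $A'$ of $A$ in $l$ lies on $x=1$; writing $A'=(1,2r)$ with $r\in\mathbb{R}$, the fold line is $l_r$, the perpendicular bisector of $A$ and $A'$, i.e. $x+ry-r^2=0$. The orbit of $P'$ is the curve $r\mapsto P'(r)$, $r\in\mathbb{R}$; the number of times it passes through $P$ is the number of $r\in\mathbb{R}$ with $P'(r)=P$. A singular point of $\mathcal{F}$ is a point of $\mathbb{R}^2$ with $F=F_x=F_y=0$. The Hessian of $F$ is the determinant $F_{xx}F_{yy}-F_{xy}F_{yx}$. $P$ is on the left side of, on, or on the right side of $\mathcal{G}$ according to whether $4p+q^2<0$, $=0$, or $>0$. An isolated point of $\mathcal{F}$ is a point of $\mathcal{F}$ having a neighbourhood in $\mathbb{R}^2$ containing no other point of $\mathcal{F}$. A self-intersection point is a point near which $\mathcal{F}$ consists of two smooth branches crossing transversally there. A cusp is a point of $\mathcal{F}$ at which $F_x=F_y=0$ and which is neither an isolated point nor a self-intersection point. *)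

(* Defs.v *)
From Stdlib Require Import Reals Lra List.
From Coquelicot Require Import Coquelicot.

Local Open Scope R_scope.

Definition point : Type := (R * R)%type.

Definition dot (u v : point) : R := fst u * fst v + snd u * snd v.
Definition cross (u v : point) : R := fst u * snd v - snd u * fst v.
Definition sub (X Y : point) : point := (fst X - fst Y, snd X - snd Y).
Definition midpoint (X Y : point) : point :=
  ((fst X + fst Y) / 2, (snd X + snd Y) / 2).

(* The line through [base] orthogonal to [normal]; it is a genuine line only
   when [normal] is nonzero, as is the case for all fold lines below. *)
Record line : Type := Line { base : point; normal : point }.

Definition on_line (l : line) (X : point) : Prop :=
  dot (sub X (base l)) (normal l) = 0.

Definition perp_bisector (X Y : point) : line := Line (midpoint X Y) (sub Y X).

Definition reflect (l : line) (X : point) : point :=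
  let k := 2 * dot (sub X (base l)) (normal l) / dot (normal l) (normal l) in
  (fst X - k * fst (normal l), snd X - k * snd (normal l)).

Definition pointA : point := (-1, 0).
Definition pointA' (r : R) : point := (1, 2 * r).
Definition fold_line (r : R) : line := perp_bisector pointA (pointA' r).

Lemma fold_line_eq (r x y : R) :
  on_line (fold_line r) (x, y) <-> x + r * y - r ^ 2 = 0.
Proof.
unfold on_line, fold_line, perp_bisector, dot, sub, midpoint; simpl.
split; intro H; lra.
Qed.

Lemma fold_line_reflectA (r : R) : reflect (fold_line r) pointA = pointA' r.
Proof.
unfold reflect, fold_line, perp_bisector, dot, sub, midpoint, pointA, pointA'.
simpl; f_equal; field; nra.
Qed.

Definition orbit (P : point) (r : R) : point := reflect (fold_line r) P.

(* [P'(r) = P] holds for exactly [n] real numbers [r]. *)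
Definition passes_times (P : point) (n : nat) : Prop :=
  exists rs : list R, NoDup rs /\ length rs = n /\
    forall r : R, In r rs <-> orbit P r = P.

Definition fold_curve (P X : point) : Prop :=
  (exists r : R, orbit P r = X) \/ X = P.

Definition cubicF (P X : point) : R :=
  let (p, q) := P in
  let (x, y) := X in
  2 * (q - y) ^ 2 - (q + y) * (q - y) * (p - x) - (p - x) ^ 2 * (p + x).

Definition dx (f : point -> R) (X : point) : R :=
  Derive (fun x => f (x, snd X)) (fst X).
Definition dy (f : point -> R) (X : point) : R :=
  Derive (fun y => f (fst X, y)) (snd X).

Definition hessian (f : point -> R) (X : point) : R :=
  dx (dx f) X * dy (dy f) X - dy (dx f) X * dx (dy f) X.

Definition singular_point (f : point -> R) (X : point) : Prop :=
  f X = 0 /\ dx f X = 0 /\ dy f X = 0.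

Definition parabG (X : point) : R := 4 * fst X + snd X ^ 2.
Definition left_of_G (X : point) : Prop := parabG X < 0.
Definition on_G (X : point) : Prop := parabG X = 0.
Definition right_of_G (X : point) : Prop := parabG X > 0.

Definition isolated_point (C : point -> Prop) (X : point) : Prop :=
  C X /\ locally X (fun Y : point => C Y -> Y = X).

Definition smooth (f : R -> R) : Prop :=
  forall (n : nat) (t : R), ex_derive_n f n t.

Definition velocity (g : R -> point) (t : R) : point :=
  (Derive (fun s => fst (g s)) t, Derive (fun s => snd (g s)) t).

(* Being injective on the compact interval [-d, d], the curve [g] is there a
   homeomorphism onto its image: it does not come back close to [g 0], as an
   injective immersion of an open interval might.  Smoothness on all of [R]
   is no restriction, up to reparametrization of a shorter arc. *)
Definition smooth_arc (d : R) (g : R -> point) : Prop :=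
  smooth (fun t => fst (g t)) /\ smooth (fun t => snd (g t)) /\
  (forall t, Rabs t <= d -> velocity g t <> (0, 0)) /\
  (forall s t, Rabs s <= d -> Rabs t <= d -> g s = g t -> s = t).

Definition self_intersection_point (C : point -> Prop) (X : point) : Prop :=
  exists (d : R) (g1 g2 : R -> point),
    0 < d /\ smooth_arc d g1 /\ smooth_arc d g2 /\
    g1 0 = X /\ g2 0 = X /\
    cross (velocity g1 0) (velocity g2 0) <> 0 /\
    locally X (fun Y : point =>
      C Y <-> exists t : R, Rabs t <= d /\ (g1 t = Y \/ g2 t = Y)).

(* [C] is the curve with equation [f = 0]. *)
Definition cusp (f : point -> R) (C : point -> Prop) (X : point) : Prop :=
  C X /\ dx f X = 0 /\ dy f X = 0 /\
  ~ isolated_point C X /\ ~ self_intersection_point C X.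

(* Main.v *)
(** In the coordinates [u = p - x], [v = q - y] centred at [P] the cubic reads
    [u (u^2 + v^2) + 2 v^2 - 2 q u v - 2 p u^2], and the line of slope [r]
    through [P] meets it again in exactly the orbit point [P'(r)], whose
    [u]-coordinate is [2 (p + r q - r^2) / (1 + r^2)].  So the orbit passes
    through [P] at the roots of [r^2 - q r - p], whose discriminant is
    [4 p + q^2].  If it is positive, the orbit near its two roots gives two
    transversal branches; if it is nonpositive, the quadratic part is
    nonnegative, hence [u <= 0] on the curve, so that every differentiable arc
    of the curve has vertical velocity at [P] and no two arcs cross
    transversally. *)
Require Import Defs.
From Stdlib Require Import Reals.
From Coquelicot Require Import Coquelicot.
From Stdlib Require Import Lra Psatz List.

Local Open Scope R_scope.

(** * The orbit and its cubic equation *)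

Definition shift (p q r : R) : R := 2 * (p + r * q - r ^ 2) / (1 + r ^ 2).

Lemma orbit_shift (p q r : R) :
  orbit (p, q) r = (p - shift p q r, q - r * shift p q r).
Proof.
unfold orbit, reflect, fold_line, perp_bisector, dot, sub, midpoint, pointA,
  pointA', shift; simpl.
f_equal; field; nra.
Qed.

Lemma shift_eq0 (p q r : R) : shift p q r = 0 <-> r ^ 2 - q * r - p = 0.
Proof.
unfold shift; assert (H : 1 + r ^ 2 <> 0) by nra; split; intro E.
- assert (E' : 2 * (p + r * q - r ^ 2) / (1 + r ^ 2) * (1 + r ^ 2) = 0)
    by (rewrite E; ring).
  field_simplify in E'; nra.
- replace (p + r * q - r ^ 2) with 0 by lra; field; nra.
Qed.

Lemma orbit_fixed (p q r : R) :
  orbit (p, q) r = (p, q) <-> r ^ 2 - q * r - p = 0.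
Proof.
rewrite <- shift_eq0, orbit_shift; split; intro E.
- injection E; lra.
- rewrite E; f_equal; ring.
Qed.

Lemma cubicF_centred (p q u v : R) :
  cubicF (p, q) (p - u, q - v) =
  u * (u ^ 2 + v ^ 2) + 2 * v ^ 2 - 2 * q * u * v - 2 * p * u ^ 2.
Proof. unfold cubicF; ring. Qed.

Lemma centred (p q : R) (X : point) :
  exists u v, X = (p - u, q - v).
Proof.
destruct X as [x y]; exists (p - x), (q - y); f_equal; ring.
Qed.

Lemma fold_curve_cubic (p q : R) (X : point) :
  fold_curve (p, q) X <-> cubicF (p, q) X = 0.
Proof.
destruct (centred p q X) as [u [v ->]].
rewrite cubicF_centred; unfold fold_curve; split.
- intros [[r E] | E].
  + rewrite orbit_shift in E; injection E; intros Ev Eu.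
    assert (Hu : u = shift p q r) by lra.
    assert (Hv : v = r * u) by (rewrite Hu; lra).
    assert (K : u * (1 + r ^ 2) = 2 * (p + r * q - r ^ 2)).
    { rewrite Hu; unfold shift; field; nra. }
    rewrite Hv.
    replace (u * (u ^ 2 + (r * u) ^ 2) + 2 * (r * u) ^ 2
             - 2 * q * u * (r * u) - 2 * p * u ^ 2)
      with (u ^ 2 * (u * (1 + r ^ 2) - 2 * (p + r * q - r ^ 2))) by ring.
    rewrite K; ring.
  + injection E; intros Ev Eu.
    replace u with 0 by lra; replace v with 0 by lra; ring.
- intro E; destruct (Req_dec u 0) as [Hu | Hu].
  + right; subst u; assert (v = 0) by nra; subst v; rewrite !Rminus_0_r; reflexivity.
  + left; exists (v / u); rewrite orbit_shift.
    assert (K : shift p q (v / u) = u).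
    { unfold shift.
      assert (0 < u ^ 2 + v ^ 2) by nra.
      assert (1 + (v / u) ^ 2 <> 0) by nra.
      (* Cleared of [1 + (v / u) ^ 2] and [u ^ 2], the claim is the cubic equation [E]. *)
      apply (Rmult_eq_reg_r (1 + (v / u) ^ 2)); [ | assumption].
      apply (Rmult_eq_reg_r (u ^ 2)); [ | nra].
      field_simplify; [ nra | assumption | split; [assumption | nra]]. }
    rewrite K; f_equal; field; assumption.
Qed.

(** * Singular point and Hessian *)

Lemma dx_cubicF (p q : R) (X : point) :
  dx (cubicF (p, q)) X =
  (q + snd X) * (q - snd X) + 2 * (p - fst X) * (p + fst X) - (p - fst X) ^ 2.
Proof.
destruct X as [x y]; unfold dx, cubicF; simpl.
apply is_derive_unique; auto_derive; [exact I | ring].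
Qed.

Lemma dy_cubicF (p q : R) (X : point) :
  dy (cubicF (p, q)) X =
  - 4 * (q - snd X) + 2 * snd X * (p - fst X).
Proof.
destruct X as [x y]; unfold dy, cubicF; simpl.
apply is_derive_unique; auto_derive; [exact I | ring].
Qed.

(* By Euler's identity for the quadratic and cubic parts of [F] at [P], both
   vanish at a singular point, so [u (u^2 + v^2) = 0]. *)
Lemma singular_point_cubicF (p q : R) (X : point) :
  singular_point (cubicF (p, q)) X <-> X = (p, q).
Proof.
unfold singular_point; rewrite dx_cubicF, dy_cubicF; split.
- destruct (centred p q X) as [u [v ->]]; rewrite cubicF_centred; simpl fst; simpl snd.
  intros [E0 [E1 E2]].
  assert (C : u * (u ^ 2 + v ^ 2) = 0).
  { apply (f_equal (Rmult u)) in E1; apply (f_equal (Rmult v)) in E2; lra. }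
  assert (u = 0).
  { destruct (Rmult_integral _ _ C); nra. }
  subst u; assert (v = 0) by nra; subst v; rewrite !Rminus_0_r; reflexivity.
- intros ->; unfold cubicF; simpl; repeat split; ring.
Qed.

Lemma hessian_cubicF (p q : R) :
  hessian (cubicF (p, q)) (p, q) = - 4 * (4 * p + q ^ 2).
Proof.
assert (Hxx : dx (dx (cubicF (p, q))) (p, q) = - 4 * p).
{ unfold dx at 1; simpl.
  rewrite (Derive_ext _ _ _ (fun x => dx_cubicF p q (x, q))); simpl.
  apply is_derive_unique; auto_derive; [exact I | ring]. }
assert (Hxy : dy (dx (cubicF (p, q))) (p, q) = - 2 * q).
{ unfold dy at 1; simpl.
  rewrite (Derive_ext _ _ _ (fun y => dx_cubicF p q (p, y))); simpl.
  apply is_derive_unique; auto_derive; [exact I | ring]. }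
assert (Hyx : dx (dy (cubicF (p, q))) (p, q) = - 2 * q).
{ unfold dx at 1; simpl.
  rewrite (Derive_ext _ _ _ (fun x => dy_cubicF p q (x, q))); simpl.
  apply is_derive_unique; auto_derive; [exact I | ring]. }
assert (Hyy : dy (dy (cubicF (p, q))) (p, q) = 4).
{ unfold dy at 1; simpl.
  rewrite (Derive_ext _ _ _ (fun y => dy_cubicF p q (p, y))); simpl.
  apply is_derive_unique; auto_derive; [exact I | ring]. }
unfold hessian; rewrite Hxx, Hxy, Hyx, Hyy; ring.
Qed.

(** * Number of passages through [P] *)

Lemma passes_times_inj (P : point) (m n : nat) :
  passes_times P m -> passes_times P n -> m = n.
Proof.
intros [l [Nl [<- Hl]]] [k [Nk [<- Hk]]].
apply Nat.le_antisymm; apply NoDup_incl_length; try assumption;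
  intros r Hr; [apply Hk, Hl | apply Hl, Hk]; assumption.
Qed.

Lemma passes_times_0 (P : point) :
  passes_times P 0 <-> ~ (exists r : R, orbit P r = P).
Proof.
split.
- intros [l [_ [L H]]] [r Hr].
  destruct l; [exact (proj2 (H r) Hr) | discriminate].
- intro H; exists nil; split; [constructor | split; [reflexivity | ]].
  intro r; split; [intros [] | intro E; exfalso; eauto].
Qed.

Lemma left_passes_0 (p q : R) : left_of_G (p, q) -> passes_times (p, q) 0.
Proof.
unfold left_of_G, parabG; simpl; intro H; apply passes_times_0.
intros [r Hr]; apply orbit_fixed in Hr.
assert (0 <= (2 * r - q) ^ 2) by apply pow2_ge_0; nra.
Qed.

Lemma on_passes_1 (p q : R) : on_G (p, q) -> passes_times (p, q) 1.
Proof.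
unfold on_G, parabG; simpl; intro H; exists (q / 2 :: nil).
split; [repeat constructor; simpl; tauto | split; [reflexivity | ]].
intro r; rewrite orbit_fixed; simpl; split.
- intros [<- | []]; nra.
- intro E; left; assert ((2 * r - q) ^ 2 = 0) by nra; nra.
Qed.

(** Expressing [p] and [q] by the two roots keeps square roots out of the later computations. *)
Lemma right_two_roots (p q : R) : right_of_G (p, q) ->
  exists r1 r2, r1 < r2 /\ q = r1 + r2 /\ p = - (r1 * r2).
Proof.
unfold right_of_G, parabG; simpl; intro H.
set (s := sqrt (4 * p + q * (q * 1))).
assert (0 < s) by (apply sqrt_lt_R0; lra).
assert (s * s = 4 * p + q * (q * 1)) by (apply sqrt_sqrt; lra).
exists ((q - s) / 2), ((q + s) / 2); repeat split; nra.
Qed.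

Lemma right_passes_2 (p q : R) : right_of_G (p, q) -> passes_times (p, q) 2.
Proof.
intro H; destruct (right_two_roots p q H) as [r1 [r2 [lt12 [-> ->]]]].
exists (r1 :: r2 :: nil).
split; [ | split; [reflexivity | ]].
- constructor; [simpl; intros [E | []]; lra | repeat constructor; simpl; tauto].
- intro r; rewrite orbit_fixed; simpl; split.
  + intros [<- | [<- | []]]; ring.
  + intro E; assert (E' : (r - r1) * (r - r2) = 0) by nra.
    destruct (Rmult_integral _ _ E'); [left | right; left]; lra.
Qed.

Lemma G_trichotomy (X : point) : left_of_G X \/ on_G X \/ right_of_G X.
Proof.
unfold left_of_G, on_G, right_of_G.
destruct (Rtotal_order (parabG X) 0) as [H | [H | H]]; auto.
Qed.

(** * The isolated point on the left side *)

Lemma left_isolated (p q : R) :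
  left_of_G (p, q) -> isolated_point (fold_curve (p, q)) (p, q).
Proof.
unfold left_of_G, parabG; simpl; intro H.
split; [right; reflexivity | ].
(* The lowest value of the quadratic part on the unit circle is at least its
   determinant over its trace. *)
set (e := (- 4 * p - q ^ 2) / (2 - 2 * p)).
assert (0 < e) by (apply Rdiv_lt_0_compat; nra).
assert (Ee : e * (2 - 2 * p) = - 4 * p - q ^ 2) by (unfold e; field; nra).
exists (mkposreal e ltac:(assumption)).
intros Y; destruct (centred p q Y) as [u [v ->]]; intros [Bu Bv] C.
change (Rabs (p - u - p) < e) in Bu; apply Rabs_def2 in Bu.
apply fold_curve_cubic in C; rewrite cubicF_centred in C.
(* Multiplied by the trace [2 - 2 * p], the difference equals [(2 * v - q * u) ^ 2 + (q * v + 2 * p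
   * u) ^ 2]. *)
assert (D : 0 <= (2 * v ^ 2 - 2 * q * u * v - 2 * p * u ^ 2
                  - e * (u ^ 2 + v ^ 2)) * (2 - 2 * p)).
{ replace ((2 * v ^ 2 - 2 * q * u * v - 2 * p * u ^ 2
                  - e * (u ^ 2 + v ^ 2)) * (2 - 2 * p))
    with ((2 * v ^ 2 - 2 * q * u * v - 2 * p * u ^ 2) * (2 - 2 * p)
          - (e * (2 - 2 * p)) * (u ^ 2 + v ^ 2)) by ring.
  rewrite Ee.
  assert (0 <= (2 * v - q * u) ^ 2) by apply pow2_ge_0.
  assert (0 <= (q * v + 2 * p * u) ^ 2) by apply pow2_ge_0.
  lra. }
assert (0 <= 2 * v ^ 2 - 2 * q * u * v - 2 * p * u ^ 2 - e * (u ^ 2 + v ^ 2)).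
{ apply (Rmult_le_reg_r (2 - 2 * p)); nra. }
(* On the curve the quadratic part is [- u * (u ^ 2 + v ^ 2)]; the radius [e] of the ball ensures
   [u + e > 0]. *)
assert (N : (u + e) * (u ^ 2 + v ^ 2) <= 0) by nra.
assert (u ^ 2 + v ^ 2 <= 0).
{ apply (Rmult_le_reg_l (u + e)); lra. }
assert (u = 0) by nra; assert (v = 0) by nra; subst.
rewrite !Rminus_0_r; reflexivity.
Qed.

(** * Smoothness of the orbit arcs *)

(** All iterated derivatives of a member of [S] stay in [S], so no formula for the derivatives of
    order [n] has to be found. *)
Lemma smooth_of_class (S : (R -> R) -> Prop) :
  (forall f, S f -> exists g, S g /\ forall t, is_derive f t (g t)) ->
  forall f, S f -> smooth f.
Proof.
intros HS f Sf.
assert (H : forall n, exists g, S g /\ forall t, Derive_n f n t = g t).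
{ induction n as [ | n [g [Sg Eg]]]; [exists f; split; auto | ].
  destruct (HS g Sg) as [h [Sh Dh]]; exists h; split; [assumption | ].
  intro t; simpl; rewrite (Derive_ext _ _ _ Eg).
  apply is_derive_unique, Dh. }
intros [ | n] t; simpl; [exact I | ].
destruct (H n) as [g [Sg Eg]]; destruct (HS g Sg) as [h [_ Dh]].
apply (ex_derive_ext g); [intro; symmetry; apply Eg | exists (h t); apply Dh].
Qed.

(** A class closed under differentiation that contains the coordinates of the orbit arcs: the only
    denominator is that of [shift], and its inverse differentiates to a product of generators.
    Membership depends on how a function is written, hence the passage through [smooth_ext]
    below. *)
Inductive rational_expr (c : R) : (R -> R) -> Prop :=
| re_const a : rational_expr c (fun _ => a)
| re_id : rational_expr c (fun t => t)
| re_plus f g : rational_expr c f -> rational_expr c g ->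
    rational_expr c (fun t => f t + g t)
| re_mult f g : rational_expr c f -> rational_expr c g ->
    rational_expr c (fun t => f t * g t)
| re_inv : rational_expr c (fun t => / (1 + (c + t) * (c + t))).

Lemma rational_expr_smooth (c : R) (f : R -> R) :
  rational_expr c f -> smooth f.
Proof.
apply smooth_of_class; clear f.
intros f Hf; induction Hf as
  [ a | | f g Hf [f' [Hf' Df]] Hg [g' [Hg' Dg]]
  | f g Hf [f' [Hf' Df]] Hg [g' [Hg' Dg]] | ].
- exists (fun _ => 0); split; [constructor | ].
  intro t; apply (is_derive_const a t).
- exists (fun _ => 1); split; [constructor | ].
  intro t; apply (is_derive_id t).
- exists (fun t => f' t + g' t); split; [constructor; assumption | ].
  intro t; apply (is_derive_plus f g t); auto.
- exists (fun t => f' t * g t + f t * g' t); split.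
  + repeat constructor; assumption.
  + intro t; apply (is_derive_mult f g t); auto; intros; apply Rmult_comm.
- exists (fun t => (-2) * (c + t) * (/ (1 + (c + t) * (c + t))
                                     * / (1 + (c + t) * (c + t)))).
  split; [repeat constructor | ].
  intro t; assert (0 <= (c + t) ^ 2) by apply pow2_ge_0.
  auto_derive; [nra | field; nra].
Qed.

Lemma smooth_ext (f g : R -> R) : (forall t, f t = g t) -> smooth f -> smooth g.
Proof. intros E Hf n t; apply (ex_derive_n_ext f); auto. Qed.

(** The parameter is translated so that a root [r0] corresponds to time 0, where
    [self_intersection_point] expects its branches to meet. *)
Definition orbit_arc (p q r0 t : R) : point :=
  (p - shift p q (r0 + t), q - (r0 + t) * shift p q (r0 + t)).

Lemma orbit_arcE (p q r0 t : R) :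
  orbit_arc p q r0 t = orbit (p, q) (r0 + t).
Proof. symmetry; apply orbit_shift. Qed.

Lemma orbit_arc_smooth_fst (p q r0 : R) :
  smooth (fun t => fst (orbit_arc p q r0 t)).
Proof.
apply (smooth_ext (fun t => p + (-2) * (p + (r0 + t) * q
                              + (-1) * ((r0 + t) * (r0 + t)))
                              * / (1 + (r0 + t) * (r0 + t)))).
- intro t; assert (0 <= (r0 + t) ^ 2) by apply pow2_ge_0.
  unfold orbit_arc, shift; simpl; field; nra.
- apply (rational_expr_smooth r0); repeat constructor.
Qed.

Lemma orbit_arc_smooth_snd (p q r0 : R) :
  smooth (fun t => snd (orbit_arc p q r0 t)).
Proof.
apply (smooth_ext (fun t => q + (r0 + t) * ((-2) * (p + (r0 + t) * q
                              + (-1) * ((r0 + t) * (r0 + t)))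
                              * / (1 + (r0 + t) * (r0 + t))))).
- intro t; assert (0 <= (r0 + t) ^ 2) by apply pow2_ge_0.
  unfold orbit_arc, shift; simpl; field; nra.
- apply (rational_expr_smooth r0); repeat constructor.
Qed.

(** * Arcs of the curve through [P] *)

Lemma locally_arc (g : R -> point) (t : R) (S : point -> Prop) :
  ex_derive (fun s => fst (g s)) t -> ex_derive (fun s => snd (g s)) t ->
  locally (g t) S -> locally t (fun s => S (g s)).
Proof.
intros D1 D2 [e He].
assert (C1 : locally t (fun s => ball (fst (g t)) e (fst (g s))))
  by exact (ex_derive_continuous _ t D1 _ (locally_ball _ e)).
assert (C2 : locally t (fun s => ball (snd (g t)) e (snd (g s))))
  by exact (ex_derive_continuous _ t D2 _ (locally_ball _ e)).
generalize (filter_and _ _ C1 C2); apply filter_imp.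
intros s [B1 B2]; apply He; split; assumption.
Qed.

(** Were [P] isolated, the orbit would stay at [P] for all parameters near [r0], but a quadratic has
    at most one further root, at distance [q - 2 * r0] from [r0]. *)
Lemma root_not_isolated (p q r0 : R) :
  orbit (p, q) r0 = (p, q) -> ~ isolated_point (fold_curve (p, q)) (p, q).
Proof.
intros H0 [_ Hloc].
assert (E0 := proj1 (orbit_fixed _ _ _) H0).
assert (A0 : orbit_arc p q r0 0 = (p, q))
  by (rewrite orbit_arcE, Rplus_0_r; exact H0).
rewrite <- A0 in Hloc at 1.
destruct (locally_arc _ 0 _ (orbit_arc_smooth_fst p q r0 1%nat 0)
            (orbit_arc_smooth_snd p q r0 1%nat 0) Hloc) as [[e e0] He].
assert (K : forall t, 0 < t < e -> t = q - 2 * r0).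
{ intros t Ht.
  assert (B : ball 0 e t).
  { change (Rabs (t - 0) < e); rewrite Rminus_0_r; apply Rabs_def1; lra. }
  assert (E : orbit (p, q) (r0 + t) = (p, q)).
  { rewrite <- orbit_arcE; apply (He _ B); rewrite orbit_arcE.
    left; eexists; reflexivity. }
  apply orbit_fixed in E.
  assert (E' : t * (t - (q - 2 * r0)) = 0) by lra.
  destruct (Rmult_integral _ _ E'); lra. }
assert (K1 := K (e / 2)); assert (K2 := K (e / 3)); lra.
Qed.

(* The curve lies in [u <= 0], so [u] has a maximum along the arc at [P]. *)
Lemma arc_tangent (p q d : R) (g : R -> point) :
  ~ right_of_G (p, q) -> 0 < d -> smooth_arc d g -> g 0 = (p, q) ->
  locally (p, q) (fun Y : point =>
    (exists t, Rabs t <= d /\ g t = Y) -> fold_curve (p, q) Y) ->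
  fst (velocity g 0) = 0.
Proof.
intros NR d0 [Sx [Sy _]] g0 Hloc.
assert (Dx := Sx 1%nat); assert (Dy := Sy 1%nat); simpl in Dx, Dy.
assert (H : locally 0 (fun t => p <= fst (g t))).
{ assert (near : locally 0 (fun s => (exists t, Rabs t <= d /\ g t = g s) ->
                              fold_curve (p, q) (g s))).
  { apply (locally_arc g 0 (fun Y => (exists t, Rabs t <= d /\ g t = Y) ->
                              fold_curve (p, q) Y)).
    - apply Dx.
    - apply Dy.
    - rewrite g0; exact Hloc. }
  assert (small : locally 0 (fun t => Rabs t <= d)).
  { exists (mkposreal d d0); intros t Bt.
    change (Rabs (t - 0) < d) in Bt; rewrite Rminus_0_r in Bt; lra. }
  generalize (filter_and _ _ near small); apply filter_imp.
  intros t [K ht].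
  assert (C : fold_curve (p, q) (g t)) by (apply K; exists t; auto).
  apply fold_curve_cubic in C; revert C.
  destruct (centred p q (g t)) as [u [v ->]].
  rewrite cubicF_centred; simpl fst; intro C.
  unfold right_of_G, parabG in NR; simpl in NR.
  (* Twice the quadratic part is [(2 * v - q * u) ^ 2 + (- (4 * p) - q ^ 2) * u ^ 2], so [u > 0]
     would make the cubic positive. *)
  destruct (Rle_dec u 0) as [ | Hu]; [lra | exfalso].
  assert (0 < u * (u ^ 2 + v ^ 2)) by (apply Rmult_lt_0_compat; nra).
  assert (0 <= (2 * v - q * u) ^ 2) by apply pow2_ge_0.
  assert (0 <= (- (4 * p) - q ^ 2) * u ^ 2) by (apply Rmult_le_pos; nra).
  nra. }
destruct H as [[e e0] He].
unfold velocity; simpl.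
assert (Dpt : derivable_pt_lim (fun t => fst (g t)) 0
                (Derive (fun t => fst (g t)) 0)).
{ apply is_derive_Reals, Derive_correct, Dx. }
(* [derive_pt] projects the value out of its proof argument, so with this [pr] the goal is
   convertible to the form that [deriv_minimum] proves. *)
set (pr := exist _ _ Dpt : derivable_pt (fun t => fst (g t)) 0).
change (derive_pt (fun t => fst (g t)) 0 pr = 0).
apply (deriv_minimum _ (- e) e); [lra | lra | ].
intros t h1 h2; rewrite g0; simpl; apply He.
change (Rabs (t - 0) < e); rewrite Rminus_0_r; apply Rabs_def1; lra.
Qed.

Lemma not_right_not_self_intersection (p q : R) : ~ right_of_G (p, q) ->
  ~ self_intersection_point (fold_curve (p, q)) (p, q).
Proof.
intros NR [d [g1 [g2 [d0 [A1 [A2 [E1 [E2 [X Hloc]]]]]]]]]; apply X.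
unfold cross.
rewrite (arc_tangent p q d g1), (arc_tangent p q d g2); trivial.
- ring.
- revert Hloc; apply filter_imp; intros Y K [t [ht E]].
  apply K; exists t; auto.
- revert Hloc; apply filter_imp; intros Y K [t [ht E]].
  apply K; exists t; auto.
Qed.

(** * The two transversal branches on the right side *)

(** The derivative of [shift], read off by differentiating [shift p q r * (1 + r ^ 2) = 2 * (p + r *
    q - r ^ 2)]; keeping [shift] in it makes the value at a root immediate. *)
Definition shift' (p q r : R) : R :=
  (2 * q - 4 * r - 2 * r * shift p q r) / (1 + r ^ 2).

Lemma velocity_orbit_arc (p q r0 t : R) :
  velocity (orbit_arc p q r0) t =
  (- shift' p q (r0 + t),
   - shift p q (r0 + t) - (r0 + t) * shift' p q (r0 + t)).
Proof.
assert (0 <= (r0 + t) ^ 2) by apply pow2_ge_0.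
unfold velocity, orbit_arc; simpl; f_equal; apply is_derive_unique;
  unfold shift', shift; auto_derive; try nra; field; nra.
Qed.

(** The velocity vanishes only where [shift] and [shift'] both do, that is at a double root. Away
    from [P] the parameter is recovered as the slope [v / u], so only [P] could be hit twice, and
    the bound on [d] keeps the other root out of the arc. *)
Lemma orbit_arc_smooth_arc (p q r0 d : R) :
  right_of_G (p, q) -> r0 ^ 2 - q * r0 - p = 0 -> 0 < d < Rabs (q - 2 * r0) ->
  smooth_arc d (orbit_arc p q r0).
Proof.
unfold right_of_G, parabG; simpl; intros HR E0 Hd.
split; [apply orbit_arc_smooth_fst | ].
split; [apply orbit_arc_smooth_snd | ].
split.
- intros t _; rewrite velocity_orbit_arc; intro E; injection E.
  set (r := r0 + t); intros Ey Ex.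
  assert (Z' : shift' p q r = 0) by lra.
  rewrite Z' in Ey; assert (Z : shift p q r = 0) by lra.
  unfold shift' in Z'; rewrite Z in Z'; apply shift_eq0 in Z.
  assert (W : 2 * q - 4 * r - 2 * r * 0 = 0).
  { apply (Rmult_eq_reg_r (/ (1 + r ^ 2))).
    - rewrite Rmult_0_l; exact Z'.
    - apply Rinv_neq_0_compat; nra. }
  nra.
- intros s t hs ht E; unfold orbit_arc in E; injection E; intros Ey Ex.
  set (a := shift p q (r0 + s)) in *; set (b := shift p q (r0 + t)) in *.
  assert (Eab : a = b) by lra.
  destruct (Req_dec a 0) as [a0 | a0].
  + assert (b0 : b = 0) by lra.
    assert (root : forall w, Rabs w <= d -> shift p q (r0 + w) = 0 -> w = 0).
    { intros w hw Zw; apply shift_eq0 in Zw.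
      assert (Ew : w * (w - (q - 2 * r0)) = 0) by nra.
      destruct (Rmult_integral _ _ Ew) as [ | Ew']; [assumption | exfalso].
      replace w with (q - 2 * r0) in hw by lra; lra. }
    rewrite (root s), (root t); auto.
  + rewrite Eab in Ey.
    assert (s = t); [ | assumption].
    apply (Rmult_eq_reg_r b); [lra | congruence].
Qed.

(** This ensures that near [P] the curve has no points beyond the two arcs: the bound is uniform in
    [r], so distant parameters do not return close to [P] either. *)
Lemma shift_small_near_root (r1 r2 d : R) : 0 < d -> r2 - r1 = 2 * d ->
  exists e : posreal, forall r,
    Rabs (shift (- (r1 * r2)) (r1 + r2) r) < e ->
    Rabs (r - r1) <= d \/ Rabs (r - r2) <= d.
Proof.
intros d0 E.
(* With [a], [b] the distances from [r] to the roots, both above [d], [M] is such that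
   [1 + r ^ 2 <= M * (a * b)]: use [r ^ 2 <= 2 * a ^ 2 + 2 * r1 ^ 2], [d ^ 2 <= a * b] and
   [a ^ 2 <= 3 * (a * b)]. Then the absolute value of [shift] is at least [2 / M]. *)
set (M := (1 + 2 * r1 ^ 2) / d ^ 2 + 6).
assert (Md : M * d ^ 2 = 1 + 2 * r1 ^ 2 + 6 * d ^ 2).
{ unfold M; field; lra. }
assert (d2 : 0 < d ^ 2) by nra.
assert (M0 : 0 < M).
{ apply (Rmult_lt_reg_r (d ^ 2)); nra. }
exists (mkposreal (/ M) (Rinv_0_lt_compat _ M0)); simpl; intros r Hr.
destruct (Rle_dec (Rabs (r - r1)) d) as [ | N1]; [auto | ].
destruct (Rle_dec (Rabs (r - r2)) d) as [ | N2]; [auto | exfalso].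
apply Rnot_le_lt in N1; apply Rnot_le_lt in N2.
set (a := Rabs (r - r1)) in *; set (b := Rabs (r - r2)) in *.
assert (r0 : 0 < 1 + r ^ 2) by nra.
assert (Hs : Rabs (shift (- (r1 * r2)) (r1 + r2) r) * (1 + r ^ 2) = 2 * (a * b)).
{ rewrite <- (Rabs_pos_eq (1 + r ^ 2)) by lra.
  unfold a, b; rewrite <- !Rabs_mult.
  replace (2 * Rabs ((r - r1) * (r - r2)))
    with (Rabs (- (2 * ((r - r1) * (r - r2))))).
  - f_equal; unfold shift; field; lra.
  - rewrite Rabs_Ropp, Rabs_mult, (Rabs_pos_eq 2); lra. }
assert (tri : a <= b + 2 * d).
{ unfold a, b; replace (r - r1) with ((r - r2) + (r2 - r1)) by ring.
  eapply Rle_trans; [apply Rabs_triang | ].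
  rewrite E, (Rabs_pos_eq (2 * d)); lra. }
assert (a2 : a ^ 2 = (r - r1) ^ 2) by (unfold a; apply pow2_abs).
assert (B1 : a ^ 2 <= 3 * (a * b)) by nra.
assert (B2 : d ^ 2 <= a * b) by nra.
assert (B3 : (1 + 2 * r1 ^ 2) <= (M - 6) * (a * b)).
{ apply Rle_trans with ((M - 6) * d ^ 2); [lra | ].
  apply Rmult_le_compat_l; [ | assumption].
  apply (Rmult_le_reg_r (d ^ 2)); nra. }
assert (B4 : 1 + r ^ 2 <= M * (a * b)).
{ assert (r ^ 2 <= 2 * (r - r1) ^ 2 + 2 * r1 ^ 2)
    by (assert (0 <= (r - 2 * r1) ^ 2) by apply pow2_ge_0; nra).
  lra. }
assert (B5 : 2 * (a * b) < / M * (1 + r ^ 2)).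
{ rewrite <- Hs; apply Rmult_lt_compat_r; assumption. }
assert (B6 : / M * (1 + r ^ 2) <= a * b).
{ apply (Rmult_le_reg_l M); [assumption | ].
  rewrite <- Rmult_assoc, Rinv_r by lra; lra. }
nra.
Qed.

Lemma right_self_intersection (p q : R) : right_of_G (p, q) ->
  self_intersection_point (fold_curve (p, q)) (p, q).
Proof.
intro HR.
destruct (right_two_roots p q HR) as [r1 [r2 [lt12 [Eq Ep]]]].
(* Half the gap between the roots: each arc avoids the other root, whose distance is [2 * d]. *)
set (d := (r2 - r1) / 2).
assert (d0 : 0 < d) by (unfold d; lra).
assert (R1 : r1 ^ 2 - q * r1 - p = 0) by (rewrite Eq, Ep; ring).
assert (R2 : r2 ^ 2 - q * r2 - p = 0) by (rewrite Eq, Ep; ring).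
exists d, (orbit_arc p q r1), (orbit_arc p q r2).
split; [assumption | ].
split; [apply orbit_arc_smooth_arc; trivial | ].
{ split; [assumption | ]; rewrite Rabs_pos_eq; unfold d; lra. }
split; [apply orbit_arc_smooth_arc; trivial | ].
{ split; [assumption | ]; rewrite Rabs_left; unfold d; lra. }
split; [rewrite orbit_arcE, Rplus_0_r; apply orbit_fixed; assumption | ].
split; [rewrite orbit_arcE, Rplus_0_r; apply orbit_fixed; assumption | ].
split.
(* At a root the velocity is [(1, r)] times the nonzero factor [- shift' p q r], and the slopes [r1]
   and [r2] differ. *)
- rewrite !velocity_orbit_arc, !Rplus_0_r; unfold cross, shift'; simpl fst; simpl snd.
  rewrite (proj2 (shift_eq0 p q r1) R1), (proj2 (shift_eq0 p q r2) R2), Eq.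
  replace (- ((2 * (r1 + r2) - 4 * r1 - 2 * r1 * 0) / (1 + r1 ^ 2)) * _ - _)
    with (- 4 * (r2 - r1) ^ 3 / ((1 + r1 ^ 2) * (1 + r2 ^ 2)))
    by (field; split; nra).
  apply Rmult_integral_contrapositive; split.
  + assert (0 < (r2 - r1) ^ 3) by (apply pow_lt; lra); lra.
  + apply Rinv_neq_0_compat; assert (0 <= r1 ^ 2) by apply pow2_ge_0.
    assert (0 <= r2 ^ 2) by apply pow2_ge_0; nra.
- destruct (shift_small_near_root r1 r2 d) as [e He];
    [assumption | unfold d; field | ].
  rewrite <- Eq, <- Ep in He.
  exists e; intros Y [Bx _]; split.
  + intros [[r E] | ->].
    * assert (Bs : Rabs (shift p q r) < e).
      { rewrite orbit_shift in E; rewrite <- E in Bx.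
        change (Rabs (p - shift p q r - p) < e) in Bx.
        rewrite <- Rabs_Ropp.
        replace (- shift p q r) with (p - shift p q r - p) by ring; exact Bx. }
      destruct (He r Bs) as [h | h]; [exists (r - r1) | exists (r - r2)];
        (split; [assumption | ]); [left | right];
        rewrite orbit_arcE, <- E; f_equal; ring.
    * exists 0; split; [rewrite Rabs_R0; lra | left].
      rewrite orbit_arcE, Rplus_0_r; apply orbit_fixed; assumption.
  + intros [t [_ [E | E]]]; rewrite orbit_arcE in E; left; eexists; exact E.
Qed.

Theorem theorem1p3 (p q : R) :
  let P : point := (p, q) in
  (forall X : point, fold_curve P X <-> cubicF P X = 0) /\
  (forall X : point, singular_point (cubicF P) X <-> X = P) /\
  hessian (cubicF P) P = - 4 * (4 * p + q ^ 2) /\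
  ((left_of_G P <-> ~ (exists r : R, orbit P r = P)) /\
   (~ (exists r : R, orbit P r = P) <-> isolated_point (fold_curve P) P)) /\
  ((on_G P <-> passes_times P 1) /\
   (passes_times P 1 <-> cusp (cubicF P) (fold_curve P) P)) /\
  ((right_of_G P <-> passes_times P 2) /\
   (passes_times P 2 <-> self_intersection_point (fold_curve P) P)).
Proof.
intro P.
split; [exact (fold_curve_cubic p q) | ].
split; [exact (singular_point_cubicF p q) | ].
split; [exact (hessian_cubicF p q) | ].
assert (isol : isolated_point (fold_curve P) P ->
               ~ exists r, orbit P r = P).
{ intros I [r Hr]; exact (root_not_isolated p q r Hr I). }
destruct (proj2 (singular_point_cubicF p q P) eq_refl) as [_ [Fx Fy]].
assert (CP : fold_curve P P) by (right; reflexivity).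
assert (L0 := left_passes_0 p q); assert (O1 := on_passes_1 p q).
assert (R2 := right_passes_2 p q).
assert (LI := left_isolated p q); assert (RS := right_self_intersection p q).
assert (NS := not_right_not_self_intersection p q).
assert (excl := passes_times_inj P); fold P in L0, O1, R2, LI, RS, NS.
(* Not passing through [P] becomes the count 0. The three sides of the parabola are exhaustive and
   the three counts exclude each other, so the one-way implications collected above yield all the
   equivalences. *)
rewrite <- passes_times_0 in *; unfold cusp.
assert (n01 : passes_times P 0 -> passes_times P 1 -> False)
  by (intros H K; discriminate (excl _ _ H K)).
assert (n02 : passes_times P 0 -> passes_times P 2 -> False)
  by (intros H K; discriminate (excl _ _ H K)).
assert (n12 : passes_times P 1 -> passes_times P 2 -> False)
  by (intros H K; discriminate (excl _ _ H K)).
destruct (G_trichotomy P) as [T | [T | T]]; tauto.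
Qed.
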